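(* Let $N,m,t,\ell$ be positive integers with $1<t<m$, $m\mid t^2-1$ and $\ell\in\{(t-1,m)/2,\,(t-1,m)\}$. Let $\mathcal{M}=\mathcal{CM}(\Gamma,\{\omega_1,\ldots,\omega_m\})$ be an $m$-valent regular $t$-balanced Cayley map on an abelian group $\Gamma$ such that $\exp(\Gamma^{+})=N$, $\rho(\omega_i)=\omega_{i+1}$ and $\omega_{\ell+ti}=\omega_i^{-1}$ for $1\le i\le m$ (subscripts modulo $m$). Then $\mathcal{M}\cong\mathcal{M}_Q$ for a unique ideal $Q\in\mathcal{I}(N,\ell,m,t)$.
   Context: Cayley maps. Let $\Gamma$ be a finite group and $\Omega$ a generating set not containing the identity and closed under inverses. The Cayley graph has vertex set $\Gamma$ and arc set $\Gamma\times\Omega$, where $(\eta,\omega)$ is the arc from $\eta$ to $\eta\omega$. Given a cyclic permutation $\rho$ of $\Omega$ (a single cycle of length $|\Omega|$), the Cayley map $\mathcal{CM}(\Gamma,\Omega,\rho)$ is the Cayley graph together with the rotation $(\eta,\omega)\mapsto(\eta,\rho(\omega))$ on arcs (equivalently, the induced embedding in a closed oriented surface). It is $|\Omega|$-valent. An isomorphism $\mathcal{CM}(\Gamma,\Omega,\rho)\to\mathcal{CM}(\Gamma',\Omega',\rho')$ is an isomorphism of the underlying graphs whose induced bijection on arcs $\alpha$ satisfies $\alpha\circ\rho=\rho'\circ\alpha$, where $\rho,\rho'$ denote the rotations on arcs. A Cayley map is regular if for any two arcs there is a unique automorphism sending one to the other. If $\Omega=\{\omega_1,\ldots,\omega_m\}$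 and $\rho(\omega_i)=\omega_{i+1}$ (subscripts mod $m$), write $\mathcal{CM}(\Gamma,\{\omega_1,\dots,\omega_m\})$. A regular Cayley map is $t$-balanced if $\rho(\omega)^{-1}=\rho^{t}(\omega^{-1})$ for all $\omega\in\Omega$. For a regular $t$-balanced Cayley map with $1<t<|\Omega|$, $\Gamma^{+}$ is the subgroup (of index $2$ in $\Gamma$) consisting of all products of an even number of elements of $\Omega$. $\exp$ denotes the exponent of a group, and $(a,b)$ the greatest common divisor. Rings. $\mathbb{Z}_N=\mathbb{Z}/N\mathbb{Z}$; for an ideal $Q\le\mathbb{Z}_N[x]$, $F_N(Q)=\mathbb{Z}_N[x]/Q$ (also regarded as an additive group), and $\overline{\alpha}$ is the image of $\alpha$ in $F_N(Q)$. For an element $\alpha$ of a ring, $[u]_\alpha=1+\alpha+\cdots+\alpha^{u-1}$. $\mathcal{I}(N,\ell,m,t)$ is the set of ideals $Q\le\mathbb{Z}_N[x]$ such that in $F_N(Q)$: $[m]_{\overline{x}}=0$; for positive integers $u$, $[u]_{\overline{x}}=0$ if and only if $m\mid u$; $\overline{x}^{(t-1,m)}=1$; and $\overline{x}^{\ell}+[t]_{\overline{x}}=0$. For $Q\in\mathcal{I}(N,\ell,m,t)$, $\Gamma_Q=\langle F_N(Q),\omega\mid 2\omega=-[\ell]_{\overline{x}}\rangle$ is the abelian group generated by the additive group $F_N(Q)$ and an element $\omega$ with the additional relation $2\omega=-[\ell]_{\overline{x}}$, and $\mathcal{M}_Q=\mathcal{CM}(\Gamma_Q,\{[i]_{\overline{x}}+\omega\colon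 1\le i\le m\})$, with the cyclic order given by $i$. *)

(* Defs.v *)
From HB Require Import structures.
From mathcomp Require Import all_boot all_algebra fingroup abelian.
From mathcomp Require Import ring_quotient zify boolp.

Set Implicit Arguments.
Unset Strict Implicit.
Unset Printing Implicit Defensive.

Import GRing.Theory.

Section CayleyMaps.
Local Open Scope group_scope.

(* Only the values of [cm_rot] on [cm_gens] matter; the axioms on the pair
   (cm_gens, cm_rot) are in [is_cayley_map].  The carrier is a [groupType] rather
   than a [finGroupType] so that quotient groups can be used directly;
   finiteness is part of [is_cayley_map]. *)
Record cayley_map (G : groupType) := CayleyMap {
  cm_gens : {pred G};
  cm_rot : G -> G
}.

Definition cyclic_perm_on (T : Type) (S : {pred T}) (f : T -> T) : Prop :=
  [/\ {in S, forall x, f x \in S},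
      {in S &, injective f}
    & {in S &, forall x y, exists k : nat, iter k f x = y}].

Variables G H : groupType.

Definition is_word (M : cayley_map G) (s : seq G) (g : G) : Prop :=
  all (mem (cm_gens M)) s /\ g = \prod_(x <- s) x.

Definition is_cayley_map (M : cayley_map G) : Prop :=
  [/\ exists s : seq G, forall g, g \in s,
      1 \notin cm_gens M,
      {in cm_gens M, forall x, x^-1 \in cm_gens M},
      forall g, exists s, is_word M s g
    & cyclic_perm_on (cm_gens M) (cm_rot M)].

Definition even_product (M : cayley_map G) (g : G) : Prop :=
  exists2 s, ~~ odd (size s) & is_word M s g.

Definition adjacent (M : cayley_map G) (x y : G) : Prop :=
  exists2 w, w \in cm_gens M & y = x * w.

(* The arc (x, w) goes from x to x * w. *)
Definition is_arc (M : cayley_map G) (a : G * G) : Prop := a.2 \in cm_gens M.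

Definition arc_rot (M : cayley_map G) (a : G * G) : G * G := (a.1, cm_rot M a.2).

(* The bijection on arcs induced by a graph isomorphism f: the arc from x to
   x * w is sent to the arc from f x to f (x * w). *)
Definition arc_map (f : G -> H) (a : G * G) : H * H :=
  (f a.1, (f a.1)^-1 * f (a.1 * a.2)).

End CayleyMaps.

Definition map_iso (G H : groupType) (M : cayley_map G) (M' : cayley_map H)
    (f : G -> H) : Prop :=
  [/\ bijective f,
      forall x y, adjacent M x y <-> adjacent M' (f x) (f y)
    & forall a, is_arc M a ->
        arc_map f (arc_rot M a) = arc_rot M' (arc_map f a)].

Definition isomorphic_maps (G H : groupType)
    (M : cayley_map G) (M' : cayley_map H) : Prop :=
  exists f, map_iso M M' f.

Definition regular_map (G : groupType) (M : cayley_map G) : Prop :=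
  forall a b, is_arc M a -> is_arc M b ->
    exists! f, map_iso M M f /\ arc_map f a = b.

Definition regular_t_balanced (G : groupType) (M : cayley_map G) (t : nat)
    : Prop :=
  regular_map M /\
  {in cm_gens M, forall w, ((cm_rot M w)^-1 = iter t (cm_rot M) (w^-1))%g}.

Definition even_part (gT : finGroupType) (M : cayley_map gT) : {set gT} :=
  [set g | `[< even_product M g >]].

(* CM(G, {w_1, ..., w_m}) for a duplicate-free list [:: w_1; ...; w_m]: the
   rotation sends each entry to the cyclically next one. *)
Definition cayley_map_of_seq (G : groupType) (s : seq G) : cayley_map G :=
  CayleyMap (mem s) (next s).

Local Open Scope ring_scope.
Local Open Scope quotient_scope.

(* [u]_a *)
Definition geom (R : pzRingType) (u : nat) (a : R) : R := \sum_(i < u) a ^+ i.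

(* ['Z_N] is Z/NZ for N > 1 only; ['Z_1] is Z/2Z.  A nontrivial Cayley map of
   valency > 1 has even part of exponent > 1, so N = 1 never arises.
   The library's [idealr] are the proper ideals of a commutative ring; the
   condition defining [ideal_family] forces properness as soon as m > 1
   (take u = 1). *)
Definition FQ (N : nat) (Q : idealr {poly 'Z_N}) : comNzRingType :=
  {ideal_quot Q}.

Definition xbar (N : nat) (Q : idealr {poly 'Z_N}) : FQ Q :=
  \pi_({ideal_quot Q}) 'X.

Definition ideal_family (N l m t : nat) (Q : idealr {poly 'Z_N}) : Prop :=
  [/\ geom m (xbar Q) = 0,
      forall u : nat, (0 < u)%N -> (geom u (xbar Q) = 0 <-> (m %| u)%N),
      xbar Q ^+ gcdn (t - 1) m = 1
    & xbar Q ^+ l + geom t (xbar Q) = 0].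

(* For an abelian group V and a in V, the group generated by V and omega with
   the additional relation 2 omega = - a is (V x Z omega) / <(a, 2)>. *)
Section Adjoin.
Variables (V : zmodType) (a : V).

Definition relator : {pred V * int} :=
  fun u => `[< exists k : int, u = (a, 2%:Z) *~ k >].

Fact relator_zmod_closed : zmod_closed relator.
Proof.
split=> [|u v /asboolP[j ->] /asboolP[k ->]]; apply/asboolP.
  by exists 0; rewrite mulr0z.
by exists (j - k); rewrite mulrzBr.
Qed.
HB.instance Definition _ :=
  GRing.isZmodClosed.Build (V * int)%type relator relator_zmod_closed.

Definition adjoin : zmodType := Quotient.quot relator.
Definition adjoin_inj (v : V) : adjoin := \pi_(Quotient.quot relator) (v, 0).
Definition adjoin_omega : adjoin := \pi_(Quotient.quot relator) (0, 1).

End Adjoin.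

Definition Gamma_Q (N l : nat) (Q : idealr {poly 'Z_N}) : groupType :=
  Algebra.to_multiplicative (adjoin (geom l (xbar Q))).

Definition omega_Q (N l : nat) (Q : idealr {poly 'Z_N}) (i : nat)
    : Gamma_Q l Q :=
  adjoin_inj (geom l (xbar Q)) (geom i (xbar Q)) +
  adjoin_omega (geom l (xbar Q)).

Definition M_Q (N l m : nat) (Q : idealr {poly 'Z_N})
    : cayley_map (Gamma_Q l Q) :=
  cayley_map_of_seq [seq omega_Q l Q i | i <- iota 1 m].

(* [M_Q] is indeed a Cayley map: the remaining facts lead to
   [M_Q_is_cayley_map]. *)
Section AdjoinFacts.
Variables (V : zmodType) (a : V).
Local Notation inj := (adjoin_inj a).
Local Notation omega := (adjoin_omega a).
Local Notation quo := (Quotient.quot (relator a)).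

Fact adjoin_inj_additive : zmod_morphism inj.
Proof.
move=> u v; rewrite /adjoin_inj -[RHS]raddfB; apply: congr1.
by congr (_, _); rewrite /= subr0.
Qed.
HB.instance Definition _ :=
  GRing.isZmodMorphism.Build V (adjoin a) inj adjoin_inj_additive.

Fact adjoin_omega2 : omega *+ 2 = - inj a.
Proof.
apply/eqP; rewrite -addr_eq0 -raddfMn -raddfD /=.
rewrite -[X in _ == X](raddf0 \pi_quo).
rewrite -Quotient.idealrBE subr0; apply/asboolP; exists 1.
by rewrite mulr1z; congr (_, _); rewrite /= ?add0r ?addr0.
Qed.

Fact adjoin_inj_inj : injective inj.
Proof.
move=> u v /eqP; rewrite -Quotient.idealrBE => /asboolP[k] uvk.
have := congr1 fst uvk; have := congr1 snd uvk.
rewrite (raddfMz snd) (raddfMz fst) /= subr0 => /esym/eqP.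
rewrite -mulrzr mulf_eq0 /= intz => /eqP->; rewrite mulr0z => /eqP.
by rewrite subr_eq0 => /eqP.
Qed.

Fact adjoin_omega_notin v : omega != inj v.
Proof.
rewrite -Quotient.idealrBE; apply/asboolP=> -[k] /(congr1 snd).
rewrite (raddfMz snd) /= subr0 -mulrzr intz => /(congr1 absz).
by rewrite abszM /= => /(congr1 odd); rewrite oddM.
Qed.

Fact adjoin_elim (g : adjoin a) : exists v, g = inj v \/ g = inj v + omega.
Proof.
rewrite -[g](@reprK _ quo); case: (generic_quotient.repr (g : quo)) => v k.
have -> : \pi_quo (v, k) = inj v + omega *~ k :> adjoin a.
  rewrite /adjoin_inj -raddfMz -raddfD; apply: congr1; congr (_, _).
    by rewrite /= (raddfMz fst) mul0rz addr0.
  by rewrite /= (raddfMz snd) add0r /= -mulrzr mul1r intz.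
rewrite (divz_eq k 2).
rewrite mulrzDr mulrC mulrzA -pmulrn adjoin_omega2 -raddfN -raddfMz addrA -raddfD.
move: (v + _) => {}v; exists v.
have: (0 <= (k %% 2)%Z)%R by rewrite modz_ge0.
have: ((k %% 2)%Z < 2)%R by rewrite ltz_pmod.
case: ((k %% 2)%Z) => // -[|[|//]] _ _; first by left; rewrite mulr0z addr0.
by right; rewrite mulr1z.
Qed.
End AdjoinFacts.

Section GeomFacts.
Variable R : comNzRingType.
Implicit Types (x : R) (u v : nat).

Lemma geomD x u v : geom (u + v) x = geom u x + x ^+ u * geom v x.
Proof.
rewrite /geom big_split_ord /= mulr_sumr; congr (_ + _).
by apply: eq_bigr => i _; rewrite exprD.
Qed.

Lemma geomM x t i : x ^+ t = x -> geom (t * i) x = geom t x * geom i x.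
Proof.
move=> xt; elim: i => [|i IHi]; first by rewrite muln0 /geom !big_ord0 mulr0.
rewrite mulnS addnC geomD IHi exprM xt -addn1 geomD mulrDr.
by rewrite [geom 1 x]big_ord1 expr0 mulr1 [x ^+ i * _]mulrC.
Qed.
End GeomFacts.

Section CyclicNext.
Variables (T : choiceType) (s : seq T).
Hypothesis s_uniq : uniq s.

Lemma cyclic_next : cyclic_perm_on (mem s) (next s).
Proof.
split=> [x|x y _ _|x y]; first by rewrite -mem_next.
  exact: (can_inj (prev_next s_uniq)).
move=> xs ys; have [i s' def_s] := rot_to xs.
have: fcycle (next s) (x :: s') by rewrite -def_s rot_cycle cycle_next.
rewrite /= => /fpathP[n def_p]; have: y \in rcons s' x.
  by rewrite mem_rcons -def_s mem_rot.
by rewrite def_p => /trajectP[k _ ->]; exists k.+1; rewrite iterSr.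
Qed.
End CyclicNext.

Section MQWellDefined.
Variables (N l m t : nat) (Q : idealr {poly 'Z_N}).
Hypothesis m_gt0 : (0 < m)%N.
Hypothesis t_gt1 : (1 < t)%N.
Hypothesis l_val : (2 * l = gcdn (t - 1) m \/ l = gcdn (t - 1) m)%N.
Hypothesis Q_family : ideal_family l m t Q.

Local Notation x := (xbar Q).
Local Notation a := (geom l (xbar Q)).
Local Notation d := (gcdn (t - 1) m).
Local Notation inj := (adjoin_inj a).
Local Notation omega := (omega_Q l Q).
Local Notation piQ := \pi_({ideal_quot Q}).

Lemma d_gt0 : (0 < d)%N. Proof. by rewrite gcdn_gt0 m_gt0 orbT. Qed.

Lemma xbar_expd k : (d %| k)%N -> x ^+ k = 1.
Proof. by case: Q_family => _ _ xd _ /dvdnP[q ->]; rewrite mulnC exprM xd expr1n. Qed.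

Lemma pi_geom : forall p : {poly 'Z_N}, exists v : 'rV['Z_N]_d, piQ p = piQ (rVpoly v).
Proof.
move=> p; have Xm : 'X^d - 1 \is @monic 'Z_N.
  by rewrite -[1]/(1%:P) monicXnsubC // d_gt0.
exists (poly_rV (Pdiv.Ring.rmodp p ('X^d - 1))).
rewrite poly_rV_K; last first.
  have := Pdiv.Ring.ltn_rmodpN0 p (monic_neq0 Xm).
  by rewrite size_XnsubC ?d_gt0.
rewrite [in LHS](Pdiv.RingMonic.rdivp_eq Xm p) rmorphD rmorphM rmorphB rmorphXn rmorph1.
case: Q_family => _ _ + _; rewrite /xbar => ->.
by rewrite subrr mulr0 add0r.
Qed.

Lemma omega_add i k : (m %| k)%N -> omega (i + k) = omega i.
Proof.
move=> mk; have [_ gm _ _] := Q_family; rewrite /omega_Q geomD.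
have -> : geom k x = 0.
  have [->|k0] := posnP k; first by rewrite /geom big_ord0.
  exact/gm.
by rewrite mulr0 addr0.
Qed.

Lemma omega_inj i j : (0 < i <= m)%N -> (0 < j <= m)%N -> omega i = omega j -> i = j.
Proof.
wlog le_ij : i j / (i <= j)%N => [W|] hi hj.
  by case/orP: (leq_total i j) => ? e; [|apply/esym]; apply: W.
move=> /addIr/adjoin_inj_inj; rewrite -(subnKC le_ij) geomD => /eqP.
rewrite -subr_eq0 opprD addrA subrr sub0r oppr_eq0 => /eqP g0.
apply/eqP; rewrite -{1}[i]addn0 eqn_add2l eq_sym -leqn0 leqNgt; apply/negP => ij0.
have {}g0 : geom (j - i) x = 0.
  rewrite -[LHS]mul1r -(xbar_expd (dvdn_mulr i (dvdnn d))).
  rewrite -(prednK d_gt0) mulSn addnC exprD -mulrA g0 mulr0 //.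
have [_ gm _ _] := Q_family; move/gm: g0 => /(_ ij0) /dvdn_leq => /(_ ij0).
by move: hi hj; lia.
Qed.

Definition om_seq := [seq omega i | i <- iota 1 m].

Lemma om_seqP g : reflect (exists i, g = omega i) (g \in om_seq).
Proof.
apply: (iffP mapP) => [[i _ ->]|[i ->]]; first by exists i.
have im := ltn_pmod i m_gt0.
have [i0|i0] := posnP (i %% m); [exists m | exists (i %% m)%N].
- by rewrite mem_iota m_gt0 add1n /=.
- by rewrite -[in RHS](add0n m) (omega_add 0) // (divn_eq i m) i0 addnC omega_add ?dvdn_mull.
- by rewrite mem_iota i0 add1n ltnS ltnW.
by rewrite {1}(divn_eq i m) addnC omega_add ?dvdn_mull.
Qed.

Lemma omega_opp i : - (omega i : adjoin a) = omega (l + t * i).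
Proof.
have [_ _ _ lt0] := Q_family.
have xt : x ^+ t = x.
  by rewrite -(subnK (ltnW t_gt1)) addn1 exprS xbar_expd ?mulr1 // dvdn_gcdl.
have x2l : x ^+ l * x ^+ l = 1.
  by rewrite -exprD addnn -mul2n xbar_expd //; case: l_val => [->|{1}<-];
    rewrite ?dvdn_mull.
rewrite /omega_Q geomD geomM //.
have -> : geom t x = - x ^+ l by apply/eqP; rewrite -addr_eq0 addrC lt0.
rewrite mulrA mulrN x2l mulN1r opprD raddfB /=.
have -> : inj a = - adjoin_omega a - adjoin_omega a.
  by rewrite -opprD -mulr2n adjoin_omega2 opprK.
by rewrite addrAC subrK addrC.
Qed.

Lemma om_seq_uniq : uniq om_seq.
Proof.
rewrite map_inj_in_uniq ?iota_uniq // => i j.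
rewrite !mem_iota add1n !ltnS; exact: omega_inj.
Qed.

Local Notation M := (M_Q l m Q).
Local Notation word g := (exists s, is_word M s (g : Gamma_Q l Q)).

Lemma wordD g h : word g -> word h -> word (g + h : adjoin a).
Proof.
move=> [s [ss ->]] [u [uu ->]]; exists (s ++ u); split; first by rewrite all_cat ss.
by rewrite big_cat.
Qed.

Lemma word_omega i : word (omega i).
Proof.
exists [:: omega i]; split; last by rewrite big_seq1.
by rewrite /= andbT; apply/om_seqP; exists i.
Qed.

Lemma word_nat (g : adjoin a) k : word g -> word (g *+ k).
Proof.
move=> wg; elim: k => [|k IHk]; first by exists [::]; split; rewrite ?big_nil.
by rewrite mulrS; apply: wordD.
Qed.

Lemma word_exp i : word (inj (x ^+ i)).
Proof.
have -> : inj (x ^+ i) = omega i.+1 - omega i :> adjoin a.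
  rewrite /omega_Q opprD addrACA subrr addr0 -raddfB -addn1 geomD.
  by rewrite [geom 1 _]big_ord1 mulr1 addrC addKr.
by rewrite omega_opp; apply: wordD; apply: word_omega.
Qed.

Lemma word_inj (p : {poly 'Z_N}) : word (inj (piQ p)).
Proof.
rewrite -[p]coefK poly_def !rmorph_sum raddf_sum.
elim/big_ind: _ => [|g h|i _]; [exact: (word_nat 0 (word_exp 0)) | exact: wordD |].
rewrite -[p`_i]natr_Zp scaler_nat !raddfMn; move: (word_exp i); rewrite /xbar -rmorphXn.
exact: word_nat.
Qed.

Lemma M_Q_is_cayley_map : is_cayley_map M.
Proof.
split.
- exists ([seq inj (piQ (rVpoly v)) | v <- enum 'rV['Z_N]_d] ++
          [seq inj (piQ (rVpoly v)) + adjoin_omega a | v <- enum 'rV['Z_N]_d]).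
  move=> g; have [f gE] := adjoin_elim g.
  have [v fE] := pi_geom (generic_quotient.repr (f : {ideal_quot Q})).
  rewrite reprK in fE; rewrite mem_cat; apply/orP.
  by case: gE => ->; [left|right]; apply/mapP; exists v; rewrite ?mem_enum // fE.
- apply/om_seqP => -[i /esym/eqP].
  rewrite /omega_Q addrC addr_eq0 -raddfN => /eqP/esym/eqP.
  by rewrite eq_sym (negPf (adjoin_omega_notin _ _)).
- by move=> _ /om_seqP[i ->]; apply/om_seqP; exists (l + t * i)%N; exact: omega_opp.
- move=> g; have [f] := adjoin_elim g.
  have wf : word (inj f) by rewrite -[f](@reprK _ {ideal_quot Q}); exact: word_inj.
  case=> [->|->] //; apply: wordD => //.
  have <- : omega 0 = adjoin_omega a.
    by rewrite /omega_Q [geom 0 _]big_ord0 raddf0 add0r.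
  exact: word_omega.
- exact/cyclic_next/om_seq_uniq.
Qed.
End MQWellDefined.

(* Main.v *)
(* For a map isomorphism f and a vertex x there is d with
   f (x w_i) = f x w'_{i+d} for all i; reading each edge from both ends shows
   that d gets multiplied by t when x moves to a neighbour.  As t^2 = 1 mod m,
   the differences delta_k = w_{k+1} - w_k are shifted by the same d all over
   the even part: with ev p = sum_k p_k delta_k, and ev' its analogue in the
   target, f (ev p) = f 0 + ev' (X^d p).
   For the automorphism w_i |-> w_{i+1} supplied by regularity this makes
   Q = {p | ev p = 0} an ideal, and commutativity of the group yields the
   relations of the family; then ev p |-> p, w_0 |-> omega identifies the map
   with M_Q.  For an isomorphism onto M_{Q'} it gives p in Q iff X^d p in Q',
   and X is invertible modulo Q'. *)
From HB Require Import structures.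
Require Import Defs.
From mathcomp Require Import all_boot all_algebra fingroup abelian.
From mathcomp Require Import ring_quotient zify boolp.

Set Implicit Arguments.
Unset Strict Implicit.
Unset Printing Implicit Defensive.

Import GRing.Theory.

(** * How a map isomorphism shifts the indices of the generators at each vertex *)

Section Shifts.
Local Open Scope group_scope.

(** The common form to which both the given map and [M_Q] are brought. The index runs over all
    naturals, so subscripts are never reduced; the last clause makes it an index modulo m. *)
Definition indexed_by (G : groupType) (m l t : nat) (M : cayley_map G)
    (w : nat -> G) : Prop :=
  [/\ forall g, g \in cm_gens M <-> exists i, g = w i,
      forall i, cm_rot M (w i) = w i.+1,
      forall i, w (l + t * i)%N = (w i)^-1
    & forall i j, w i = w j <-> i = j %[mod m]].

Variables (G H : groupType) (m l t : nat).
Variables (M : cayley_map G) (M' : cayley_map H).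
Variables (w : nat -> G) (w' : nat -> H).
Hypotheses (Mw : indexed_by m l t M w) (Mw' : indexed_by m l t M' w').
Hypothesis tt1 : t * t = 1 %[mod m].
Variable f : G -> H.
Hypothesis f_iso : map_iso M M' f.

Definition shifts (d : nat) (x : G) : Prop :=
  forall i, f (x * w i) = f x * w' (i + d)%N.

Lemma shifts_mod d d' x : d = d' %[mod m] -> shifts d x -> shifts d' x.
Proof.
case: Mw' => _ _ _ w'mod dd' fx i; rewrite fx; congr (_ * _).
by apply/w'mod; rewrite -modnDmr dd' modnDmr.
Qed.

(** The image of the arc along [w 0] determines d; commutation with the rotation then forces the
    images of the other arcs at x. *)
Lemma shifts_exists x : exists d, shifts d x.
Proof.
have [_ f_adj f_rot] := f_iso; have [genM rotM _ _] := Mw.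
have [genM' rotM' _ _] := Mw'.
have /f_adj[_ /genM'[d ->] fd] : adjacent M x (x * w 0).
  by exists (w 0) => //; apply/genM; exists 0%N.
exists d; elim=> [|i IHi]; first exact: fd.
have /f_rot/(congr1 snd) : is_arc M (x, w i) by apply/genM; exists i.
rewrite /= rotM IHi mulKg rotM' addSn => <-.
by rewrite mulKVg.
Qed.

(* Read the edge {x, x w_i} from both ends: its two arcs are mutually inverse
   and the rotation multiplies by t when a generator is inverted. *)
Lemma shifts_mul d x i : shifts d x -> shifts (t * d) (x * w i).
Proof.
move=> fx; have [e fe] := shifts_exists (x * w i).
have [_ _ invM _] := Mw; have [_ _ invM' w'mod] := Mw'.
apply: (shifts_mod _ fe); have := fe (l + t * i)%N.
rewrite invM mulgK fx -mulgA -[LHS]mulg1 => /mulgI/esym/eqP.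
rewrite mulg_eq1 => /eqP/(congr1 (@inv _)); rewrite invgK -invM' => /w'mod/eqP.
by rewrite mulnDr addnA eqn_modDl => /eqP.
Qed.

(** A difference is two steps, along [w i] and then [w (l + t * j)]: the shift becomes t d and then
    t^2 d, which is d modulo m. *)
Lemma shifts_diff d x i j : shifts d x ->
  f (x * (w i * (w j)^-1)) = f x * (w' (i + d)%N * (w' (j + d)%N)^-1) /\
  shifts d (x * (w i * (w j)^-1)).
Proof.
move=> fx; have [_ _ invM _] := Mw; have [_ _ invM' _] := Mw'.
have fxi := shifts_mul i fx; rewrite -invM mulgA; split.
  by rewrite fxi fx -invM' mulnDr addnA mulgA.
apply: shifts_mod (shifts_mul _ fxi).
by rewrite mulnA -modnMml tt1 modnMml mul1n.
Qed.

End Shifts.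

(** * Evaluation of polynomials over ['Z_N] in a group *)

Section PolyZp.
Local Open Scope ring_scope.
Variable N : nat.

(** Coefficients are residues of naturals, so every polynomial is a finite sum of monomials with
    coefficient 1, repetitions allowed. *)
Lemma poly_Zp_ind (P : {poly 'Z_N} -> Prop) :
  P 0 -> (forall p k, P p -> P (p + 'X^k)) -> forall p, P p.
Proof.
(* Unlike [P], the property [K] is stable under sums, as [big_ind] requires. *)
move=> P0 PX p; pose K r := forall q, P q -> P (q + r).
suff: K p by move=> /(_ 0 P0); rewrite add0r.
have K0 : K 0 by move=> q; rewrite addr0.
have KD r s : K r -> K s -> K (r + s).
  by move=> Kr Ks q Pq; rewrite addrA; apply/Ks/Kr.
rewrite -[p]coefK poly_def; elim/big_ind: _ => // i _.
rewrite -[p`_i]natr_Zp scaler_nat; elim: (nat_of_ord p`_i) => [|n IHn].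
  by rewrite mulr0n.
by rewrite mulrS; apply: KD => // q; apply: PX.
Qed.

Section Evaluation.
Variables (V : zmodType) (delta : nat -> V).
Hypotheses (N_gt1 : (1 < N)%N) (delta_N : forall k, delta k *+ N = 0).

(** Coefficients act through their representatives in nat; this is additive because N kills every
    [delta k]. *)
Definition poly_sum (p : {poly 'Z_N}) : V :=
  \sum_(k < size p) delta k *+ nat_of_ord p`_k.

Lemma poly_sum_widen n (p : {poly 'Z_N}) : (size p <= n)%N ->
  poly_sum p = \sum_(k < n) delta k *+ nat_of_ord p`_k.
Proof.
move=> le_pn; rewrite /poly_sum.
rewrite (big_ord_widen _ (fun k => delta k *+ nat_of_ord p`_k) le_pn).
rewrite big_mkcond; apply: eq_bigr => i _; case: ltnP => // /(nth_default 0) ->.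
by rewrite mulr0n.
Qed.

Lemma poly_sumD : {morph poly_sum : p q / p + q}.
Proof.
move=> p q; set n := maxn (size p) (size q).
rewrite !(@poly_sum_widen n) ?leq_maxl ?leq_maxr ?size_polyD //.
rewrite -big_split; apply: eq_bigr => i _; rewrite /= -mulrnDr coefD.
set a := nat_of_ord p`_i; set b := nat_of_ord q`_i.
have -> : (p`_i + q`_i : 'Z_N) = ((a + b) %% N)%N :> nat.
  by congr (_ %% _)%N; exact: Zp_cast.
by rewrite {2}(divn_eq (a + b) N) mulrnDr mulnC mulrnA delta_N mul0rn add0r.
Qed.

Lemma poly_sumXn k : poly_sum 'X^k = delta k.
Proof.
rewrite /poly_sum size_polyXn (bigD1 ord_max) //= coefXn eqxx.
rewrite big1 ?addr0 // => i ik; rewrite coefXn.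
by have /negPf -> : (i : nat) != k by [].
Qed.

Lemma poly_sum0 : poly_sum 0 = 0.
Proof. by rewrite /poly_sum size_poly0 big_ord0. Qed.

Lemma poly_sumB : {morph poly_sum : p q / p - q}.
Proof.
by move=> p q; apply: (addIr (poly_sum q)); rewrite -poly_sumD !subrK.
Qed.

End Evaluation.

(** Adds the monomials of p one at a time. The invariant [S] keeps the same shift available at each
    intermediate vertex. *)
Lemma shift_poly (V W : zmodType) (ev : {poly 'Z_N} -> V)
    (ev' : {poly 'Z_N} -> W) (g : V -> W) (S : V -> Prop) (d : nat) :
    {morph ev : p q / p + q} -> {morph ev' : p q / p + q} ->
    (forall x k, S x -> g (x + ev 'X^k) = g x + ev' 'X^(k + d) /\
                        S (x + ev 'X^k)) ->
  forall x p, S x -> g (x + ev p) = g x + ev' (p * 'X^d) /\ S (x + ev p).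
Proof.
move=> evD evD' step x p Sx.
have ev0 : ev 0 = 0 by apply: (addrI (ev 0)); rewrite -evD !addr0.
have ev0' : ev' 0 = 0 by apply: (addrI (ev' 0)); rewrite -evD' !addr0.
elim/poly_Zp_ind: p => [|p k [IHg IHS]]; first by rewrite mul0r ev0 ev0' !addr0.
have [gk Sk] := step _ k IHS.
by rewrite evD addrA gk IHg mulrDl evD' -exprD addrA.
Qed.

End PolyZp.

(** * An abelian finite group in additive notation *)

Section AdditiveGroup.
Local Open Scope group_scope.
Variable gT : finGroupType.

(** The commutativity proof is a parameter so that the additive structure can depend on it; the
    carrier stays [gT], so maps on [gT] are reused by conversion. *)
Definition additive_group of abelian [set: gT] : Type := gT.

Variable gT_abelian : abelian [set: gT].
Local Notation V := (additive_group gT_abelian).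

HB.instance Definition _ := Choice.on V.

Let mulC : commutative (@mulg gT).
Proof. by move=> x y; apply: (centsP gT_abelian); rewrite inE. Qed.

HB.instance Definition _ :=
  GRing.isZmodule.Build V (@mulgA gT) mulC (@mul1g gT) (@mulVg gT).

Lemma additive_groupX (x : gT) n : ((x : V) *+ n)%R = x ^+ n.
Proof. by elim: n => [|n IHn]; rewrite ?mulr0n // mulrS expgS -IHn. Qed.

End AdditiveGroup.

(** * Periodic sequences and the cyclic order of one period *)

Section Periodic.
Variables (T : eqType) (m : nat) (w : nat -> T).
Hypotheses (m_gt0 : 0 < m) (w_mod : forall i, w (i + m) = w i).

Lemma periodic_eq i j : i = j %[mod m] -> w i = w j.
Proof.
have wq k q : w (k + q * m) = w k.
  by elim: q => [|q IHq]; rewrite ?addn0 // mulSn addnCA addnC w_mod.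
by move=> ij; rewrite (divn_eq i m) (divn_eq j m) ij ![_ + _ %% m]addnC !wq.
Qed.

Lemma modn_representative i : exists2 j, 1 <= j <= m & i = j %[mod m].
Proof.
have im := ltn_pmod i m_gt0; have [i0|i0] := posnP (i %% m).
  by exists m; rewrite ?m_gt0 ?leqnn // i0 modnn.
by exists (i %% m); rewrite ?modn_mod // i0 ltnW.
Qed.

Lemma periodic_mem g : (g \in [seq w i | i <- iota 1 m]) <-> exists i, g = w i.
Proof.
split=> [/mapP[i _ ->]|[i ->]]; first by exists i.
have [j jm ij] := modn_representative i; apply/mapP; exists j.
  by rewrite mem_iota add1n ltnS.
exact: periodic_eq.
Qed.

Lemma periodic_inj : uniq [seq w i | i <- iota 1 m] ->
  forall i j, w i = w j <-> i = j %[mod m].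
Proof.
move=> w_uniq i j; split; last exact: periodic_eq.
have [i' im ii'] := modn_representative i.
have [j' jm jj'] := modn_representative j.
rewrite (periodic_eq ii') (periodic_eq jj') ii' jj' => wij; congr (_ %% _).
have nthw k : 1 <= k <= m -> nth (w 0) [seq w i | i <- iota 1 m] k.-1 = w k.
  move=> km; rewrite (nth_map 0) ?size_iota ?nth_iota; try lia.
  by congr w; lia.
move/eqP: wij; rewrite -(nthw i') // -(nthw j') // nth_uniq //; last 2 first.
- by rewrite size_map size_iota; lia.
- by rewrite size_map size_iota; lia.
by move/eqP; lia.
Qed.

Lemma periodic_next i : uniq [seq w i | i <- iota 1 m] ->
  next [seq w i | i <- iota 1 m] (w i) = w i.+1.
Proof.
move=> w_uniq; have [j jm ij] := modn_representative i.
rewrite (periodic_eq ij) (@periodic_eq i.+1 j.+1); last first.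
  by rewrite -addn1 -modnDml ij modnDml addn1.
have nthw : nth (w 0) [seq w i | i <- iota 1 m] j.-1 = w j.
  rewrite (nth_map 0) ?size_iota ?nth_iota; try lia.
  by congr w; lia.
rewrite next_nth; have -> : w j \in [seq w i | i <- iota 1 m].
  by apply/periodic_mem; exists j.
rewrite -{2}nthw index_uniq //; last by rewrite size_map size_iota; lia.
move: jm; case: (m) w_mod => [|n] wS; first by lia.
move=> jn /=; have [jn1|jn1] := ltnP j n.+1.
  rewrite (nth_map 0) ?size_iota ?nth_iota; try lia.
  by congr w; lia.
(* For j = m the tail is exhausted; the default of [nth] is the head [w 1], which equals
   [w (1 + m)]. *)
rewrite nth_default ?size_map ?size_iota; last by lia.
by rewrite -(wS 1); congr w; lia.
Qed.

End Periodic.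

(** * The indexing of the generators of [M_Q] *)

Section MQIndexed.
Variables (N l m t : nat) (Q : idealr {poly 'Z_N}).
Hypotheses (m_gt0 : 0 < m) (t_gt1 : 1 < t).
Hypothesis l_val : 2 * l = gcdn (t - 1) m \/ l = gcdn (t - 1) m.
Hypothesis Q_family : ideal_family l m t Q.

Lemma M_Q_indexed : indexed_by m l t (M_Q l m Q) (omega_Q l Q).
Proof.
have w_mod i : omega_Q l Q (i + m) = omega_Q l Q i.
  exact: omega_add Q_family _ _ _.
have w_uniq := om_seq_uniq m_gt0 t_gt1 l_val Q_family.
split.
- exact: periodic_mem.
- by move=> i; apply: periodic_next.
- by move=> i; rewrite -(omega_opp t_gt1 l_val Q_family).
- exact: periodic_inj.
Qed.

Lemma pi_idealr p : (\pi_({ideal_quot Q})%qT p = 0)%R <-> p \in Q.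
Proof.
rewrite -[(0 : {ideal_quot Q})%R](raddf0 \pi_({ideal_quot Q})%qT).
by split=> [/eqP|h]; [|apply/eqP]; rewrite -Quotient.idealrBE subr0.
Qed.

End MQIndexed.

Lemma idealr_exists (R : nzRingType) (S : {pred R}) :
  idealr_closed S -> exists Q : idealr R, Q =i S.
Proof.
move=> S_closed.
pose Q : idealr R :=
  HB.pack (S : R -> bool) (isIdealr.Build R S S_closed).
by exists Q.
Qed.

(** Hence evaluation in [M_Q] is reduction modulo Q followed by [adjoin_inj]. *)
Lemma next_omega_sub (N l : nat) (Q : idealr {poly 'Z_N}) k :
  ((omega_Q l Q k.+1 : adjoin (geom l (xbar Q))) - omega_Q l Q k
     = adjoin_inj (geom l (xbar Q)) (xbar Q ^+ k))%R.
Proof.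
rewrite /omega_Q opprD addrACA subrr addr0 -raddfB -addn1 geomD.
by rewrite [geom 1 _]big_ord1 mulr1 addrC addKr.
Qed.

(** * The kernel of evaluation as an ideal *)

Section IdealOfMap.
Local Open Scope ring_scope.
Variables (N m t l : nat) (gT : finGroupType) (gT_abelian : abelian [set: gT]).
Local Notation V := (additive_group gT_abelian).
Variables (M : cayley_map gT) (w : nat -> V).
Hypotheses (N_gt1 : (1 < N)%N) (t_gt1 : (1 < t)%N) (t_ltm : (t < m)%N).
Hypotheses (tt1 : (t * t)%N = 1%N %[mod m]) (Mw : indexed_by m l t M w).
Hypothesis delta_N : forall k, (w k.+1 - w k) *+ N = 0.
Variable f : V -> V.
Hypotheses (f_iso : map_iso M M f) (f_shift : @shifts gT gT w w f 1 (0 : V)).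

Local Notation ev := (poly_sum (fun k => w k.+1 - w k) : {poly 'Z_N} -> V).
Let evD := poly_sumD N_gt1 delta_N.
Let evB := poly_sumB N_gt1 delta_N.
Let evX k : ev 'X^k = w k.+1 - w k. Proof. exact: poly_sumXn. Qed.
Let ev0 := poly_sum0 N (fun k => w k.+1 - w k).

Let m_gt0 : (0 < m)%N. Proof. exact: leq_ltn_trans t_ltm. Qed.

Lemma invw i : w (l + t * i) = - w i.
Proof. by case: Mw. Qed.

Lemma w_l : w l = - w 0.
Proof. by rewrite -invw muln0 addn0. Qed.

Lemma w_modm i j : w i = w j <-> i = j %[mod m].
Proof. by case: Mw. Qed.

Lemma ev_shift (W : zmodType) (M' : cayley_map (Algebra.to_multiplicative W))
    (w' : nat -> W) (ev' : {poly 'Z_N} -> W) (g : V -> W) d (x : V)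
    (p : {poly 'Z_N}) :
    indexed_by m l t M' w' -> map_iso M M' g ->
    {morph ev' : q r / q + r} -> (forall k, ev' 'X^k = w' k.+1 - w' k) ->
    @shifts gT (Algebra.to_multiplicative W) w w' g d x ->
  g (x + ev p) = g x + ev' (p * 'X^d) /\
  @shifts gT (Algebra.to_multiplicative W) w w' g d (x + ev p).
Proof.
move=> Mw' g_iso evD' evX' gx.
pose S := @shifts gT (Algebra.to_multiplicative W) w w' g d.
apply: (@shift_poly N V W ev ev' g S d) gx => // {}x k gx.
rewrite evX evX'; exact: (shifts_diff Mw Mw' tt1 g_iso k.+1 k gx).
Qed.

Lemma ev_shift_auto p :
  f (ev p) = f 0 + ev (p * 'X) /\ @shifts gT gT w w f 1 (ev p).
Proof.
pose S := @shifts gT gT w w f 1.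
rewrite -[ev p]add0r.
apply: (@shift_poly N V V ev ev f S 1) => // x k fx.
by rewrite !evX; exact: (shifts_diff Mw Mw tt1 f_iso k.+1 k fx).
Qed.

(** [ev (p * 'X)] is [f (ev p) - f 0], so it depends only on the value [ev p]. *)
Lemma ev_mulX p : ev p = 0 -> ev (p * 'X) = 0.
Proof.
move=> p0; have [+ _] := ev_shift_auto p.
by rewrite p0 -[X in X = _]addr0 => /addrI.
Qed.

Lemma ev_mul q p : ev p = 0 -> ev (q * p) = 0.
Proof.
move=> p0; elim/poly_Zp_ind: q => [|q k IHq]; first by rewrite mul0r ev0.
rewrite mulrDl evD IHq add0r; elim: k => [|k IHk]; first by rewrite mul1r.
by rewrite exprS -mulrA mulrC ev_mulX.
Qed.

Lemma ev_geom u : ev (geom u 'X) = w u - w 0.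
Proof.
elim: u => [|u IHu]; first by rewrite /geom big_ord0 ev0 subrr.
rewrite /geom big_ord_recr evD evX [X in X + _]IHu.
by rewrite addrC addrA subrK.
Qed.

Lemma ev_ideal : exists Q : idealr {poly 'Z_N}, forall p, p \in Q <-> ev p = 0.
Proof.
have [|Q QE] := @idealr_exists {poly 'Z_N} [pred p | ev p == 0].
  split; rewrite ?inE ?ev0 ?eqxx //.
    (* Properness: [ev 1] is [w 1 - w 0], nonzero because m > 1. *)
    rewrite -[1](expr0 'X) evX subr_eq0; apply/eqP => /w_modm.
    by rewrite mod0n modn_small // (ltn_trans t_gt1).
  move=> a u v; rewrite !inE => /eqP u0 /eqP v0.
  by rewrite evD ev_mul // v0 addr0.
by exists Q => p; rewrite QE inE; split=> /eqP.
Qed.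

(* Apply f to w_i + w_j = w_j + w_i. *)
Lemma w_exchange i j : w i.+1 + w (j + t) = w j.+1 + w (i + t).
Proof.
have fw k n : f (w k + w n) = f 0 + w k.+1 + w (n + t).
  have /(_ k) := f_shift; rewrite mul1g addn1 => fk.
  have fkn := shifts_mul Mw Mw f_iso k f_shift n.
  rewrite muln1 mul1g fk in fkn; exact: fkn.
by have := fw i j; rewrite addrC fw -!addrA => /addrI.
Qed.

(** * The defining relations of the ideal family *)

Section Family.
Variable Q : idealr {poly 'Z_N}.
Hypothesis QE : forall p, p \in Q <-> ev p = 0.
Local Notation piQ := (\pi_({ideal_quot Q})%qT).

Lemma pi_eq0 p : piQ p = 0 <-> ev p = 0.
Proof. by rewrite pi_idealr. Qed.

Lemma pi_eq p q : piQ p = piQ q <-> ev p = ev q.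
Proof.
split=> /eqP; rewrite -subr_eq0 => /eqP h; apply/eqP;
  rewrite -subr_eq0; apply/eqP.
  by rewrite -evB; apply/pi_eq0; rewrite raddfB.
by rewrite -raddfB; apply/pi_eq0; rewrite evB.
Qed.

Lemma pi_geom_X u : piQ (geom u 'X) = geom u (xbar Q).
Proof.
by rewrite /geom rmorph_sum; apply: eq_bigr => i _; rewrite rmorphXn.
Qed.

Lemma pi_Xn u : piQ 'X^u = xbar Q ^+ u.
Proof. by rewrite rmorphXn. Qed.

Lemma ev_ideal_family : ideal_family l m t Q.
Proof.
have geom0 u : geom u (xbar Q) = 0 <-> (m %| u)%N.
  rewrite -pi_geom_X pi_eq0 ev_geom; split.
    by move/eqP; rewrite subr_eq0 => /eqP/w_modm; rewrite mod0n => /eqP.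
  move=> mu; apply/eqP; rewrite subr_eq0; apply/eqP/w_modm.
  by rewrite mod0n; apply/eqP.
have xm : xbar Q ^+ m = 1.
  rewrite -[RHS](expr0 (xbar Q)) -!pi_Xn; apply/pi_eq; rewrite !evX.
  by congr (_ - _); apply/w_modm; rewrite ?modnn ?mod0n // -addn1 modnDl.
(* The exchange relation at the indices -1 and 0 gives delta_{t-1} = delta_0; adding m keeps the
   indices natural. *)
have xt1 : xbar Q ^+ (t - 1) = 1.
  suff: xbar Q ^+ (t - 1 + m) = xbar Q ^+ m by rewrite exprD xm mulr1.
  rewrite -!pi_Xn; apply/pi_eq; rewrite !evX.
  have -> : (t - 1 + m = m.-1 + t)%N by lia.
  have := w_exchange m.-1 m; rewrite prednK // => h.
  apply/eqP; rewrite subr_eq addrAC eq_sym subr_eq -h.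
  by rewrite addrC; apply/eqP; congr (w _ + _); lia.
split=> //.
- exact/geom0.
- have [a _ /dvdnP[q qE]] := @Bezoutl m (t - 1) m_gt0.
  have : xbar Q ^+ (q * m) = 1 by rewrite mulnC exprM xm expr1n.
  by rewrite -qE exprD [(a * _)%N]mulnC exprM xt1 expr1n mulr1 gcdnC.
(* Since w_l = -w_0, the value is w_{l+1} + w_t, and exchange at 0 and l turns it into w_1 + w_{l+t}
   = 0. *)
- rewrite -pi_Xn -pi_geom_X -raddfD; apply/pi_eq0; rewrite evD evX ev_geom w_l.
  have := w_exchange 0 l; have := invw 1; rewrite muln1 add0n => ->.
  by rewrite subrr opprK addrACA subrr addr0 => <-.
Qed.

(** * The isomorphism onto [M_Q] *)

Local Notation a := (geom l (xbar Q)).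
Local Notation inj := (adjoin_inj a).
Local Notation omega := (adjoin_omega a).

Hypothesis l_val : (2 * l = gcdn (t - 1) m \/ l = gcdn (t - 1) m)%N.
Hypothesis M_words : forall g : V, exists s, is_word M s g.

(** [f] has shift 1 at every [ev p] but shift t at [w 0], and 1 < t < m. *)
Lemma w0_notin_ev p : w 0 <> ev p.
Proof.
move=> w0p; have [_ f1] := ev_shift_auto p; rewrite -w0p in f1.
have ft := shifts_mul Mw Mw f_iso 0 f_shift; rewrite mul1g in ft.
have := f1 0; rewrite (ft 0) => /mulgI/w_modm.
have m_gt1 := ltn_trans t_gt1 t_ltm.
by rewrite !add0n muln1 !modn_small // => t1; have := t_gt1; rewrite t1.
Qed.

(** The graph of the isomorphism. As a relation it needs no choice of p for a given y. *)
Definition same_coords (y : V) (z : adjoin a) : Prop := exists p,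
  (y = ev p /\ z = inj (piQ p)) \/ (y = ev p + w 0 /\ z = inj (piQ p) + omega).

(** For two odd elements, 2 w_0 = -ev [l], from w_l = -w_0, matches 2 omega = -[l]. *)
Lemma same_coordsD y z y' z' :
  same_coords y z -> same_coords y' z' -> same_coords (y + y') (z + z').
Proof.
have w00 : w 0 + w 0 = ev (- geom l 'X).
  by rewrite -[- _]sub0r evB ev0 sub0r ev_geom opprB w_l opprK.
have omega2 : omega + omega = inj (piQ (- geom l 'X)).
  by rewrite -mulr2n adjoin_omega2 -raddfN -pi_geom_X -raddfN.
move=> [p py] [q qy]; case: py => -[-> ->]; case: qy => -[-> ->].
- by exists (p + q); left; rewrite evD !raddfD.
- by exists (p + q); right; rewrite evD !raddfD !addrA.
- by exists (p + q); right; rewrite evD !raddfD; split; apply: addrAC.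
- exists (p + q - geom l 'X); left.
  by rewrite !evD -w00 !raddfD /= -omega2; split; rewrite addrACA.
Qed.

Lemma same_coords_w i : same_coords (w i) (omega_Q l Q i).
Proof. by exists (geom i 'X); right; rewrite ev_geom subrK pi_geom_X. Qed.

(** Gives well-definedness and injectivity together: [ev] has kernel Q, and on both sides the odd
    coset misses the even part. *)
Lemma same_coords_eq y z y' z' :
  same_coords y z -> same_coords y' z' -> y = y' <-> z = z'.
Proof.
have w0p p q : ev p <> ev q + w 0.
  move/(canLR (addKr _)) => h; apply: (@w0_notin_ev (p - q)).
  by rewrite evB -h addrC.
have op p q : inj (piQ p) <> inj (piQ q) + omega.
  move/(canLR (addKr _)); rewrite addrC -raddfB => /esym/eqP.
  exact/negP/adjoin_omega_notin.
move=> [p py] [q qy]; case: py => -[-> ->]; case: qy => -[-> ->].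
- by rewrite -pi_eq; split=> [->|/adjoin_inj_inj].
- by split=> [/w0p|/op].
- by split=> /esym => [/w0p|/op].
- by split=> /addIr => [/pi_eq|/adjoin_inj_inj/pi_eq] ->.
Qed.

Lemma same_coords_totall y : exists z, same_coords y z.
Proof.
have [s [ss ->]] := M_words y.
elim: s ss => [_|x s IHs /= /andP[/= xM /IHs[z xz]]].
  by exists 0, 0; left; rewrite big_nil ev0 !raddf0.
have [/(_ x)[+ _] _ _ _] := Mw => /(_ xM)[i ->].
exists (omega_Q l Q i + z : adjoin a); rewrite big_cons.
exact: same_coordsD (same_coords_w i) xz.
Qed.

Lemma same_coords_totalr z : exists y, same_coords y z.
Proof.
have [v] := adjoin_elim z; rewrite -[v](@reprK _ {ideal_quot Q}).
move: (generic_quotient.repr _) => p [->|->].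
  by exists (ev p), p; left.
by exists (ev p + w 0), p; right.
Qed.

(** Choice turns the relation into an additive bijection sending [w i] to [omega_Q l Q i], hence
    respecting edges and rotation. *)
Lemma M_iso_M_Q : isomorphic_maps M (M_Q l m Q).
Proof.
have [h hP] := choice same_coords_totall.
have [k kP] := choice same_coords_totalr.
have [genM rotM _ _] := Mw.
have [genQ rotQ _ _] := M_Q_indexed m_gt0 t_gt1 l_val ev_ideal_family.
have hD y y' : h (y + y') = h y + h y'.
  exact/(same_coords_eq (hP _) (same_coordsD (hP _) (hP _))).
have hw i : h (w i) = omega_Q l Q i.
  exact/(same_coords_eq (hP _) (same_coords_w i)).
have hI : injective h by move=> y y' /(same_coords_eq (hP _) (hP _)).
exists h; split.
- by exists k => [y|z]; [apply/(same_coords_eq (kP _) (hP _))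
                       | apply/(same_coords_eq (hP _) (kP _))].
- move=> x y; split=> [[_ /genM[i ->] ->]|[_ /genQ[i ->] hy]].
    by exists (omega_Q l Q i); [apply/genQ; exists i | rewrite -hw; apply: hD].
  exists (w i); first by apply/genM; exists i.
  by apply: hI; rewrite hy -hw; apply/esym/hD.
- case=> x _ /genM[i /= ->]; rewrite /arc_map /arc_rot /=; congr (_, _).
  have hsub (y : gT) : ((h x : Gamma_Q l Q)^-1 * h (x * y) = h y)%g.
    exact: (canLR (mulKg (h x : Gamma_Q l Q)) (hD x y)).
  by rewrite !hsub rotM !hw rotQ.
Qed.

(** With d the shift of g at the identity, injectivity of g gives [ev p = 0] exactly when X^d p lies
    in Q'. *)
Lemma M_Q_unique (Q' : idealr {poly 'Z_N}) :
  ideal_family l m t Q' -> isomorphic_maps M (M_Q l m Q') -> Q' =i Q.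
Proof.
move=> Q'_family [g g_iso]; set a' := geom l (xbar Q').
have MQ'w := M_Q_indexed m_gt0 t_gt1 l_val Q'_family.
have [d gd] := shifts_exists Mw MQ'w g_iso 1%g.
pose ev' p := adjoin_inj a' (\pi_({ideal_quot Q'})%qT p).
have ev'D : {morph ev' : p q / p + q} by move=> p q; rewrite /ev' !raddfD.
have ev'X k : ev' 'X^k = (omega_Q l Q' k.+1 : adjoin a') - omega_Q l Q' k.
  by rewrite next_omega_sub /ev' rmorphXn.
have xm : xbar Q' ^+ m = 1.
  exact: xbar_expd Q'_family _ (dvdn_gcdr _ _).
have gev p : (g (ev p) : adjoin a') = (g (0 : V) : adjoin a') + ev' (p * 'X^d).
  have [<- _] := ev_shift p MQ'w g_iso ev'D ev'X gd.
  by apply: (f_equal g); exact/esym/(@mul1g gT).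
have g_inj : injective g by case: g_iso => /bij_inj.
have ev'0 p : ev' p = 0 <-> p \in Q'.
  rewrite -pi_idealr; split=> [|p0]; last by rewrite /ev' p0 raddf0.
  by rewrite -(raddf0 (adjoin_inj a')) => /adjoin_inj_inj.
have Q'X p : p * 'X^d \in Q' <-> p \in Q'.
  rewrite -!pi_idealr rmorphM rmorphXn /=; split=> [|->]; last by rewrite mul0r.
  (* This power inverts X^d modulo Q', since X^m = 1 there. *)
  move/(congr1 (fun z => z * xbar Q' ^+ (m * d - d))).
  rewrite mul0r -mulrA -exprD subnKC ?leq_pmull // exprM xm expr1n mulr1.
  exact.
move=> p; apply/idP/idP => [/Q'X/ev'0 p0|/QE p0].
  by apply/QE/g_inj; rewrite gev p0; apply: addr0.
apply/Q'X/ev'0; have := gev p; rewrite p0.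
by rewrite -[X in X = _]addr0 => /addrI.
Qed.

End Family.
End IdealOfMap.

(** * From the given map to the indexed setting *)

Theorem theorem4p1 (N m t l : nat)
    (N_gt0 : 0 < N) (m_gt0 : 0 < m) (t_gt0 : 0 < t) (l_gt0 : 0 < l)
    (t_bounds : 1 < t < m) (m_dvd : m %| t ^ 2 - 1)
    (l_val : 2 * l = gcdn (t - 1) m \/ l = gcdn (t - 1) m)
    (gT : finGroupType) (abelian_gT : abelian [set: gT])
    (M : cayley_map gT) (M_cayley : is_cayley_map M)
    (M_balanced : regular_t_balanced M t)
    (M_valency : #|cm_gens M| = m)
    (exp_even : exponent (even_part M) = N)
    (* w i is omega_i; subscripts are read modulo m *)
    (w : nat -> gT) (w_mod : forall i, w (i + m) = w i)
    (w_gens : cm_gens M =i [seq w i | i <- iota 1 m])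
    (w_rot : forall i, 1 <= i <= m -> cm_rot M (w i) = w i.+1)
    (w_inv : forall i, 1 <= i <= m -> w (l + t * i) = ((w i)^-1)%g) :
  exists Q : idealr {poly 'Z_N},
    [/\ ideal_family l m t Q,
        isomorphic_maps M (M_Q l m Q)
      & forall Q' : idealr {poly 'Z_N},
          ideal_family l m t Q' -> isomorphic_maps M (M_Q l m Q') ->
          Q' =i Q].
Proof.
have /andP[t_gt1 t_ltm] := t_bounds; have m_gt1 := ltn_trans t_gt1 t_ltm.
have [_ _ _ M_words _] := M_cayley.
have w_uniq : uniq [seq w i | i <- iota 1 m].
  apply/card_uniqP; rewrite size_map size_iota -[RHS]M_valency.
  exact/esym/eq_card.
(* Periodicity carries the hypotheses from 1 <= i <= m to all indices. *)
have Mw : indexed_by m l t M w.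
  split; last exact: periodic_inj.
  - by move=> g; rewrite w_gens; apply: periodic_mem.
  - move=> i; have [j jm ij] := modn_representative m_gt0 i.
    rewrite (periodic_eq w_mod ij) w_rot //; apply: (periodic_eq w_mod).
    by rewrite -addn1 -modnDml -ij modnDml addn1.
  - move=> i; have [j jm ij] := modn_representative m_gt0 i.
    rewrite (periodic_eq w_mod ij) -w_inv //; apply: (periodic_eq w_mod).
    by apply/eqP; rewrite eqn_modDl -modnMmr ij modnMmr.
have tt1 : t * t = 1 %[mod m].
  by apply/eqP; rewrite eqn_mod_dvd ?muln_gt0 ?t_gt0 // mulnn.
have [genM _ invM w_modm] := Mw.
have gen i : w i \in cm_gens M by apply/genM; exists i.
have delta_exp k : ((w k.+1 * (w k)^-1) ^+ N = 1)%g.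
  rewrite -exp_even; apply: expg_exponent; rewrite inE; apply/asboolP.
  exists [:: w k.+1; (w k)^-1%g] => //; split; first by rewrite /= -invM !gen.
  by rewrite !big_cons big_nil mulg1.
(* N = 1 would give w_1 = w_0; its exclusion ensures that ['Z_N] is Z/NZ. *)
have N_gt1 : 1 < N.
  rewrite ltn_neqAle N_gt0 andbT; apply/eqP => N1.
  have := delta_exp 0; rewrite -N1 expg1 => /eqP.
  rewrite mulg_eq1 invgK => /eqP.
  by move/w_modm; rewrite mod0n modn_small.
pose wV : nat -> additive_group abelian_gT := w.
have delta_N k : ((wV k.+1 - wV k) *+ N = 0)%R.
  by rewrite additive_groupX; apply: delta_exp.
(* Regularity supplies the automorphism fixing the identity and sending w_0 to w_1, so its shift
   there is 1. *)
have [f [[f_iso [f1 fw0]] _]] :=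
  proj1 M_balanced (1%g, w 0) (1%g, w 1) (gen 0) (gen 1).
have f_shift : shifts w w f 1 1%g.
  have [d fd] := shifts_exists Mw Mw f_iso 1%g.
  apply: (shifts_mod Mw _ fd); apply/w_modm.
  by have := fd 0; rewrite add0n -fw0 /= => ->; rewrite mulKg.
have [Q QE] := ev_ideal N_gt1 t_gt1 t_ltm tt1 Mw delta_N f_iso f_shift.
exists Q; split.
- exact: (ev_ideal_family N_gt1 t_gt1 t_ltm tt1 Mw delta_N f_iso f_shift QE).
- exact: (M_iso_M_Q N_gt1 t_gt1 t_ltm tt1 Mw delta_N f_iso f_shift QE
            l_val M_words).
- exact: (M_Q_unique N_gt1 t_gt1 t_ltm tt1 Mw delta_N QE l_val).
Qed.
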